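(* Let $E,H,K$ be events with $HK\neq\emptyset$. Then, with the conjunction understood as a conditional random quantity in the setting of coherence, $$(E|HK)\wedge(H|K)=EH|K,$$ and $$\mathbb{P}[(E|HK)\wedge(H|K)]=P(EH|K)=P(E|HK)\,P(H|K).$$
   Context: Events are elements of a Boolean algebra, $\overline{E}$ is negation, juxtaposition is conjunction, and an event is identified with its $\{0,1\}$-valued indicator; $\mathbb{P}$ denotes prevision. For a random quantity $X$ with finitely many values, an event $H\neq\emptyset$ and an assessed prevision $\mu=\mathbb{P}(X|H)$, the conditional random quantity is $X|H=XH+\mu\overline{H}$. In particular the indicator of a conditional event is $A|H=AH+x\overline{H}$ with $x=P(A|H)$. Equality of (conditional) random quantities means equality of values in every case. Coherence: an assessment $(\mu_1,\ldots,\mu_n)$ on conditional random quantities $X_1|H_1,\ldots,X_n|H_n$ is coherent if for every nonempty $J\subseteq\{1,\ldots,n\}$ and all real $s_i$ $(i\in J)$, the values of $G=\sum_{i\in J}s_iH_i(X_i-\mu_i)$ restricted to $\bigvee_{i\in J}H_i$ satisfy $\min G\le 0\le\max G$. The probabilities and previsions of all the objects in the claim are assumed to be jointly coherent. Conjunction: given $x=P(A|H')$ and $y=P(B|K')$, $(A|H')\wedge(B|K')=(AH'BK'+x\,\overline{H'}BK'+y\,AH'\overline{K'})\,|\,(H'\vee K')$, so its value on $\overline{H'}\,\overline{K'}$ is its prevision. Here it is applied with $A|H'=E|HK$ and $B|K'=H|K$. *)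

(* Defs.v *)
From HB Require Import structures.
From mathcomp Require Import all_boot all_order all_algebra.
From mathcomp Require Import all_classical all_reals.

Set Implicit Arguments.
Unset Strict Implicit.
Unset Printing Implicit Defensive.

Import Order.TTheory GRing.Theory Num.Theory.
Local Open Scope ring_scope.

(* A case decides every event, compatibly with the Boolean operations: it is a
   Boolean homomorphism from B to {false, true}.  By Stone's theorem, an event
   differs from \bot iff it is true in some case.  (The structure
   {tblmorphism B -> bool} does not fit: its morphisms preserve \bot and \top
   but need not preserve meets and joins.) *)
Record case d (B : ctbDistrLatticeType d) := Case {
  truth :> B -> bool;
  truth_meet : forall A A' : B, truth (A `&` A')%O = truth A && truth A';
  truth_compl : forall A : B, truth (~` A)%O = ~~ truth A }.

Definition indicator (R : realType) d (B : ctbDistrLatticeType d) (A : B) :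
  case B -> R := fun w => (w A)%:R.

(* The random quantity X with finitely many values, the conditioning event H
   and the assessed prevision mu that make up X|H. *)
Record cond_rquantity (R : realType) d (B : ctbDistrLatticeType d) :=
  CondRQuantity {
    quantity : {fimfun case B >-> R};
    given : B;
    prevision : R }.

(* X|H = X H + mu ~H *)
Definition crq_value (R : realType) d (B : ctbDistrLatticeType d)
    (c : cond_rquantity R B) (w : case B) : R :=
  quantity c w * indicator R (given c) w
  + prevision c * indicator R (~` given c)%O w.

Lemma finite_range_indicator (R : realType) d (B : ctbDistrLatticeType d)
    (A : B) : finite_set (range (indicator R A)).
Proof.
apply: (@sub_finite_set _ _ (range (fun b : bool => b%:R : R))).
  by move=> _ [w _ <-]; exists (w A).
exact/finite_image/finite_finset.
Qed.

HB.instance Definition _ (R : realType) d (B : ctbDistrLatticeType d) (A : B) :=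
  FiniteImage.Build (case B) R (indicator R A) (finite_range_indicator R A).

(* A conditional event A|H together with its assessed probability. *)
Record cond_event (R : realType) d (B : ctbDistrLatticeType d) := CondEvent {
  event : B;
  event_given : B;
  probability : R }.

Definition crq_of_event (R : realType) d (B : ctbDistrLatticeType d)
    (a : cond_event R B) : cond_rquantity R B :=
  CondRQuantity (indicator R (event a)) (event_given a) (probability a).

Coercion crq_of_event : cond_event >-> cond_rquantity.

Definition gain (R : realType) d (B : ctbDistrLatticeType d) (n : nat)
    (c : 'I_n -> cond_rquantity R B) (J : {set 'I_n}) (s : 'I_n -> R)
    (w : case B) : R :=
  \sum_(i in J)
    s i * indicator R (given (c i)) w * (quantity (c i) w - prevision (c i)).

Definition is_min (R : realType) (S : set R) (m : R) : Prop :=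
  S m /\ lbound S m.

Definition is_max (R : realType) (S : set R) (m : R) : Prop :=
  S m /\ ubound S m.

(* The gain takes finitely many values, so the minimum and the maximum exist
   as soon as the disjunction of the conditioning events is possible.  For a
   singleton J, their existence says that the conditioning event is not \bot. *)
Definition coherent (R : realType) d (B : ctbDistrLatticeType d) (n : nat)
    (c : 'I_n -> cond_rquantity R B) : Prop :=
  forall (J : {set 'I_n}) (s : 'I_n -> R), J != finset.set0 ->
    let values :=
      [set gain c J s w | w in
         [set w : case B | w (\join_(i in J) given (c i))%O]]%classic in
    exists m M : R, [/\ is_min values m, is_max values M & m <= 0 <= M].

Definition conj_quantity (R : realType) d (B : ctbDistrLatticeType d)
    (a b : cond_event R B) (w : case B) : R :=
  let A := event a in let H := event_given a in let x := probability a in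
  let A' := event b in let K := event_given b in let y := probability b in
  indicator R (A `&` H `&` A' `&` K)%O w
  + x * indicator R (~` H `&` A' `&` K)%O w
  + y * indicator R (A `&` H `&` ~` K)%O w.

Lemma finite_range_conj_quantity (R : realType) d
    (B : ctbDistrLatticeType d) (a b : cond_event R B) :
  finite_set (range (conj_quantity a b)).
Proof.
rewrite /conj_quantity /=.
apply: (finite_image11 (fun u v => u + v)).
  apply: (finite_image11 (fun u v => u + v)); first exact: fimfunP.
  exact: (finite_image11 (fun u v => u * v)
            (finite_image_cst _) (fimfunP (indicator R _))).
exact: (finite_image11 (fun u v => u * v)
          (finite_image_cst _) (fimfunP (indicator R _))).
Qed.

HB.instance Definition _ (R : realType) d (B : ctbDistrLatticeType d)
    (a b : cond_event R B) :=
  FiniteImage.Build (case B) R (conj_quantity a b)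
    (finite_range_conj_quantity a b).

(* The conjunction of A|H and A'|K; z is its own assessed prevision. *)
Definition conjunction (R : realType) d (B : ctbDistrLatticeType d)
    (a b : cond_event R B) (z : R) : cond_rquantity R B :=
  CondRQuantity (conj_quantity a b) (event_given a `|` event_given b)%O z.

(* Main.v *)
Require Import Defs.
From mathcomp Require Import all_boot all_order all_algebra.
From mathcomp Require Import all_classical all_reals.
From mathcomp Require Import ring.

Import Order.TTheory GRing.Theory Num.Theory.

Local Open Scope ring_scope.

(** The conjunction is computed case by case.  Its two conditioning events are
    [H K] and [K], so it is conditioned on [H K \/ K = K]; and the terms
    weighted by [x] and [y] vanish, since [~(H K)] excludes [H K] and [~K]
    excludes [H K].  What is left is [E H K | K], which differs from [E H | K]
    only in its prevision [z] (lemma [conj_quantity_nested]).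

    The previsions are determined by coherence: a combination of bets whose
    gain is one and the same constant in all relevant cases must have gain
    zero (lemma [coherent_cst_gain]).  Buying [E H | K] and selling the
    conjunction gains [z - p] throughout [K], hence [z = p].  For the compound
    probability rule, bet [1] on [E | H K], [x] on [H | K] and [-1] on
    [E H | K]; throughout [K] the gain is
      [H (E - x) + x (H - y) - (E H - p) = p - x y],
    hence [p = x y].  Equality of the previsions then gives equality of the
    conditional random quantities outside [K] as well. *)

Lemma truth_le d (B : ctbDistrLatticeType d) (w : case B) (A A' : B) :
  (A <= A')%O -> w A -> w A'.
Proof. by move=> /meet_idPl <-; rewrite truth_meet => /andP[]. Qed.

(** Minimum and maximum of a constant gain are that constant, and coherence
    puts [0] between them.  It suffices to know the gain on an upper bound [K]
    of the conditioning events.  Bets on all the quantities at once cover the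
    bets on some of them, with stake [0] for the others. *)
Lemma coherent_cst_gain (R : realType) d (B : ctbDistrLatticeType d) n
    (c : 'I_n.+1 -> cond_rquantity R B) (K : B) (s : 'I_n.+1 -> R) (k : R) :
  coherent c -> (forall i, (given (c i) <= K)%O) ->
  (forall w : case B, w K ->
     \sum_i s i * indicator R (given (c i)) w
                * (quantity (c i) w - prevision (c i)) = k) ->
  k = 0.
Proof.
move=> coh leK gaink.
have T0 : [set: 'I_n.+1] != finset.set0.
  by apply/set0Pn; exists ord0; rewrite inE.
have gainT (w : case B) :
    w (\join_(i in [set: 'I_n.+1]) given (c i))%O ->
    gain c [set: 'I_n.+1] s w = k.
  move=> wJ; rewrite -(gaink w); last first.
    by apply: truth_le wJ; apply/joinsP.
  by apply: eq_bigl => i; rewrite inE.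
have [m [M [[[w /gainT -> <-] _] [[w' /gainT -> <-] _]]]] := coh _ s T0.
by move=> /le_anti.
Qed.

Lemma conj_quantity_nested (R : realType) d (B : ctbDistrLatticeType d)
    (E H K : B) (x y : R) (w : case B) :
  conj_quantity (CondEvent E (H `&` K)%O x) (CondEvent H K y) w
  = indicator R (E `&` H `&` K)%O w.
Proof.
rewrite /conj_quantity /indicator /= !truth_meet !truth_compl !truth_meet.
by case: (w E); case: (w H); case: (w K); rewrite /= !mulr0 !addr0.
Qed.

Theorem mainTheorem7 (R : realType) (d : Order.disp_t)
    (B : ctbDistrLatticeType d) (E H K : B) (x y p z : R) :
  (H `&` K)%O != (\bot)%O ->
  let E_HK := CondEvent E (H `&` K)%O x in
  let H_K := CondEvent H K y in
  let EH_K := CondEvent (E `&` H)%O K p in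
  let C := conjunction E_HK H_K z in
  coherent (tnth [tuple (E_HK : cond_rquantity R B);
                        (H_K : cond_rquantity R B);
                        (EH_K : cond_rquantity R B); C]) ->
  crq_value C =1 crq_value EH_K /\
  (prevision C = probability EH_K /\
   probability EH_K = probability E_HK * probability H_K).
Proof.
move=> _ E_HK H_K EH_K C coh.
have joinK : ((H `&` K) `|` K)%O = K by apply: join_r; apply: leIr.
set c := tnth _ in coh.
have leK i : (given (c i) <= K)%O.
  by rewrite /c; case: i => [[|[|[|[|//]]]]] ? /=; rewrite ?joinK ?leIr.
(* The gain at any stakes, when K is true. *)
have gainK s0 s1 s2 s3 (w : case B) : w K ->
    \sum_i tnth [tuple s0; s1; s2; s3] i * indicator R (given (c i)) w
             * (quantity (c i) w - prevision (c i))
    = s0 * (w H)%:R * ((w E)%:R - x) + s1 * ((w H)%:R - y)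
      + s2 * ((w E && w H)%:R - p) + s3 * ((w E && w H)%:R - z).
  move=> wK; rewrite !big_ord_recl big_ord0 /= conj_quantity_nested joinK.
  rewrite /indicator !truth_meet wK !andbT !mulr1 addr0 !addrA.
  by rewrite !(tnth_nth 0).
have zp : z = p.
  apply/eqP; rewrite -subr_eq0; apply/eqP.
  apply: (coherent_cst_gain _ _ _ _ _ _ (tnth [tuple 0; 0; 1; -1]) _ coh leK).
  by move=> w wK; rewrite gainK //; ring.
have pxy : p = x * y.
  apply/eqP; rewrite -subr_eq0; apply/eqP.
  apply: (coherent_cst_gain _ _ _ _ _ _ (tnth [tuple 1; x; -1; 0]) _ coh leK).
  move=> w wK; rewrite gainK //.
  by case: (w E); case: (w H); rewrite /=; ring.
split=> // w; rewrite /crq_value /= conj_quantity_nested joinK zp.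
rewrite /indicator !truth_meet truth_compl.
by case: (w K); rewrite ?andbT ?andbF ?mulr0.
Qed.
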